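(* Let $n \ge 1$ and let $\mathcal{B}$ be a translation invariant Busemann-Feller differentiation basis of sets in $\mathbb{R}^n$. Then $\mathcal{B}$ is a density basis if and only if for every $0 < \alpha < 1$ there exists $r = r(\alpha) > 0$ such that $C_{\mathcal{B}_r}(\alpha) < \infty$.
   Context: For each $x \in \mathbb{R}^n$ let $\mathcal{B}(x)$ be a nonempty collection of bounded open sets in $\mathbb{R}^n$ that contain $x$. The collection $\mathcal{B} = \cup_{x \in \mathbb{R}^n}\mathcal{B}(x)$ is a differentiation basis if for every $x$ the collection $\mathcal{B}(x)$ contains sets of arbitrarily small diameter. A Busemann-Feller basis is a differentiation basis such that if $x \in R \in \mathcal{B}(y)$ then $R \in \mathcal{B}(x)$ (so $\mathcal{B}(x) = \{R \in \mathcal{B} : x \in R\}$). The basis is translation invariant if, for all $x \in \mathbb{R}^n$, $R \in \mathcal{B}(0)$ if and only if $x + R \in \mathcal{B}(x)$. The basis $\mathcal{B}$ is a density basis if for every measurable set $E \subset \mathbb{R}^n$ and for almost every $x \in \mathbb{R}^n$, the equality $\chi_E(x) = \lim_{j \to \infty} \frac{1}{|R_j|}\int_{R_j} \chi_E$ holds for every sequence $\{R_j\}$ of sets in $\mathcal{B}(x)$ whose diameters tend to $0$. Here $|\cdot|$ is Lebesgue measure and $\chi_E$ the indicator function of $E$. The maximal operator associated to $\mathcal{B}$ is $M_{\mathcal{B}}f(x) = \sup_{R \in \mathcal{B}(x)} \frac{1}{|R|}\int_R |f|$ (for a Busemann-Feller basis this equals $\sup_{x \in R \in \mathcal{B}}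 \frac{1}{|R|}\int_R |f|$), and for $0 < \alpha < 1$ the Tauberian constant is $$C_{\mathcal{B}}(\alpha) = \sup_{E} \frac{1}{|E|}\left|\{x \in \mathbb{R}^n : M_{\mathcal{B}}\chi_E(x) > \alpha\}\right|,$$ the supremum being over measurable $E \subset \mathbb{R}^n$ with $0 < |E| < \infty$. For $r > 0$ and $x \in \mathbb{R}^n$, $\mathcal{B}_r(x) = \{R \in \mathcal{B}(x) : \operatorname{diam} R < r\}$ and $\mathcal{B}_r = \cup_{x \in \mathbb{R}^n}\mathcal{B}_r(x)$; the maximal operator associated to $\mathcal{B}_r$ is $M_{\mathcal{B}_r}f(x) = \sup_{R \in \mathcal{B}_r(x)} \frac{1}{|R|}\int_R |f|$, and for $0 < \alpha < 1$ $$C_{\mathcal{B}_r}(\alpha) = \sup_{E} \frac{1}{|E|}\left|\{x \in \mathbb{R}^n : M_{\mathcal{B}_r}\chi_E(x) > \alpha\}\right|,$$ the supremum being over measurable $E \subset \mathbb{R}^n$ with $0 < |E| < \infty$. *)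

(* Defs.v *)
From HB Require Import structures.
From mathcomp Require Import all_boot all_order all_algebra.
From mathcomp Require Import all_classical all_reals all_analysis.
Import Order.TTheory GRing.Theory Num.Theory.
Import numFieldNormedType.Exports.

Set Implicit Arguments.
Unset Strict Implicit.
Unset Printing Implicit Defensive.

Local Open Scope classical_set_scope.
Local Open Scope ring_scope.
Local Open Scope ereal_scope.

(* The dimension is n.+1: in dimension 0 no box is empty, so the outer measure
   below would not vanish on the empty set. *)
Section LebesgueOuterMeasure.
Variables (R : realType) (n : nat).
Local Notation V := 'rV[R]_n.+1.

(* A pair (a, b) encodes the half-open box with lower corner a and upper
   corner b; the box is empty, of volume 0, when b i < a i for some i. *)
Definition box (c : V * V) : set V :=
  [set x | forall i, (c.1 ord0 i < x ord0 i <= c.2 ord0 i)%R].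

Definition box_volume (c : V * V) : \bar R :=
  (\prod_(i < n.+1) Num.max 0 (c.2 ord0 i - c.1 ord0 i))%R%:E.

Definition box_cover (A : set V) : set (nat -> V * V) :=
  [set c | A `<=` \bigcup_k box (c k)].

(* Defined on all sets; it is the Lebesgue measure on its
   Caratheodory-measurable sets, see [lebesgue] below. *)
Definition lebesgue_outer (A : set V) : \bar R :=
  ereal_inf [set \sum_(k <oo) box_volume (c k) | c in box_cover A].

Lemma box_volume_ge0 c : 0 <= box_volume c.
Proof. by rewrite lee_fin; apply: prodr_ge0 => i _; rewrite le_max lexx. Qed.
Hint Resolve box_volume_ge0 : core.

Lemma lebesgue_outer_ge0 A : 0 <= lebesgue_outer A.
Proof. by apply: le_ereal_inf_tmp => _ [c _ <-]; exact: nneseries_ge0. Qed.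

Lemma lebesgue_outer0 : lebesgue_outer set0 = 0.
Proof.
apply/eqP; rewrite eq_le lebesgue_outer_ge0 andbT.
apply: ereal_inf_lbound; exists (fun=> (0%R, 0%R)) => //.
rewrite eseries0// => k _ _; rewrite /box_volume big_ord_recl.
by rewrite subrr maxxx mul0r.
Qed.

Lemma le_lebesgue_outer : {homo lebesgue_outer : A B / A `<=` B >-> A <= B}.
Proof.
move=> A B AB; apply/ereal_inf_le_tmp => _ [c Bc <-].
by exists c => //; exact: subset_trans AB Bc.
Qed.

Lemma lebesgue_outer_sigma_subadditive : sigma_subadditive lebesgue_outer.
Proof.
move=> A; have [[i ioo]|] := pselect (exists i, lebesgue_outer (A i) = +oo).
  rewrite (eseries_pinfty _ _ ioo) ?leey// => k _.
  by rewrite -ltNye (lt_le_trans _ (lebesgue_outer_ge0 _)).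
rewrite -forallNE => Aoo.
suff add2e (e : {posnum R}) : lebesgue_outer (\bigcup_k A k) <=
    \sum_(i <oo) lebesgue_outer (A i) + e%:num%:E.
  by apply/lee_addgt0Pr => _/posnumP[e]; exact: add2e.
rewrite (le_trans _ (epsilon_trick _ _ _))//; last first.
  by move=> k; exact: lebesgue_outer_ge0.
pose P k (c : nat -> V * V) := box_cover (A k) c /\
  \sum_(j <oo) box_volume (c j) <=
    lebesgue_outer (A k) + (e%:num / (2 ^ k.+1)%:R)%:E.
have [G PG] : {G : nat -> nat -> V * V & forall k, P k (G k)}.
  apply: (@choice _ _ P) => k; rewrite /P.
  have : lebesgue_outer (A k) \is a fin_num.
    by rewrite ge0_fin_numE ?lebesgue_outer_ge0// ltey; apply/eqP => /(Aoo k).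
  have ek : (0 < e%:num / (2 ^ k.+1)%:R :> R)%R by [].
  move=> /(lb_ereal_inf_adherent ek)[_ [c cA <-] /ltW cAe].
  by exists c.
have vG_ge0 x : 0 <= (box_volume \o uncurry G) x by exact: box_volume_ge0.
apply: (@le_trans _ _ (\esum_(i in setT) (box_volume \o uncurry G) i)).
  apply: ereal_inf_lbound => /=.
  have /card_esym/ppcard_eqP[f] := card_nat2.
  exists (uncurry G \o f).
    move=> t [i _] /((PG i).1)[j _ Gijt].
    by exists (f^-1%FUN (i, j)) => //=; rewrite invK ?inE.
  rewrite -(esum_pred_image (box_volume \o uncurry G) _ xpredT)
    ?[fun=> _]set_true//.
  by rewrite image_eq.
rewrite (_ : esum _ _ = \sum_(i <oo) \sum_(j <oo) box_volume (G i j)); last first.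
  pose J : nat -> set (nat * nat) := fun i => [set (i, j) | j in setT].
  rewrite (_ : setT = \bigcup_k J k); last first.
    by rewrite predeqE => -[a b]; split => // _; exists a => //; exists b.
  rewrite esum_bigcupT /=; last 2 first.
    - apply/trivIsetP => i j _ _ ij.
      rewrite predeqE => -[k m] /=; split => //= -[] [_] _ [<-{k} _].
      by move=> [m' _] [] /esym/eqP; rewrite (negbTE ij).
    - by [].
  rewrite -(image_id [set: nat]) -fun_true esum_pred_image//; last first.
    by move=> k _; exact: esum_ge0.
  apply: eq_eseriesr => /= j _.
  rewrite -(esum_pred_image (box_volume \o uncurry G) (pair j) predT)//=; last first.
    by move=> ? ? _ _; exact: (@can_inj _ _ _ snd).
  by congr esum; rewrite predeqE => -[a b]; split; move=> [i _ <-]; exists i.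
apply: lee_lim.
- by apply: is_cvg_nneseries => k *; apply: nneseries_ge0.
- apply: is_cvg_nneseries => k *; apply: adde_ge0 => //.
  exact: lebesgue_outer_ge0.
- by near=> k; apply: lee_sum => i _; exact: (PG i).2.
Unshelve. all: by end_near. Qed.

HB.instance Definition _ := isOuterMeasure.Build R V lebesgue_outer
  lebesgue_outer0 lebesgue_outer_ge0 le_lebesgue_outer
  lebesgue_outer_sigma_subadditive.

End LebesgueOuterMeasure.

Section DifferentiationBases.
Variables (R : realType) (n : nat).
Local Notation V := 'rV[R]_n.+1.

(* The measurable sets of [caratheodory_type] are all Lebesgue measurable
   sets, not only the Borel ones. *)
Definition lebesgue :
    set (caratheodory_type (@lebesgue_outer R n)) -> \bar R :=
  @lebesgue_outer R n.

HB.instance Definition _ := isMeasure.Build _ _ _ lebesgue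
  (@caratheodory_measure0 R V (@lebesgue_outer R n))
  (@caratheodory_measure_ge0 R V (@lebesgue_outer R n))
  (@caratheodory_measure_sigma_additive R V (@lebesgue_outer R n)).

Local Notation mu := lebesgue.

Definition lebesgue_measurable (E : set V) : Prop :=
  (@lebesgue_outer R n).-cara.-measurable E.

Definition average (A : set V) (f : V -> R) : \bar R :=
  (mu A)^-1 * \int[mu]_(y in A) (f y)%:E.

(* The library norm on row vectors is the sup norm, hence this one. *)
Definition euclidean_norm (x : V) : R := Num.sqrt (\sum_i x ord0 i ^+ 2)%R.

Definition diameter (A : set V) : \bar R :=
  ereal_sup [set (euclidean_norm (x - y))%:E | x in A & y in A].

Definition differentiation_basis (B : V -> set (set V)) : Prop :=
  forall x,
    [/\ B x !=set0,
        forall A, B x A -> [/\ bounded_set A, open A & A x]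
      & forall e : R, (0 < e)%R -> exists2 A, B x A & diameter A < e%:E].

Definition busemann_feller_basis (B : V -> set (set V)) : Prop :=
  differentiation_basis B /\ forall x y A, A x -> B y A -> B x A.

Definition translation_invariant (B : V -> set (set V)) : Prop :=
  forall x A, B 0%R A <-> B x [set (x + y)%R | y in A].

Definition density_basis (B : V -> set (set V)) : Prop :=
  forall E, lebesgue_measurable E ->
    {ae mu, forall x : V, forall A : nat -> set V, (forall j, B x (A j)) ->
      diameter (A j) @[j --> \oo] --> 0 ->
      average (A j) \1_E @[j --> \oo] --> (\1_E x : R)%:E}.

Definition maximal_operator (B : V -> set (set V)) (f : V -> R) (x : V) :
    \bar R :=
  ereal_sup [set average A (fun y => `|f y|%R) | A in B x].

(* [mu] is applied to a level set not assumed measurable, where it is the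
   outer measure; for a Busemann-Feller basis the level set is open. *)
Definition tauberian_constant (B : V -> set (set V)) (alpha : R) : \bar R :=
  ereal_sup
    [set (mu E)^-1 * mu [set x | alpha%:E < maximal_operator B \1_E x] |
      E in [set E | lebesgue_measurable E /\ 0 < mu E < +oo]].

Definition truncated_basis (B : V -> set (set V)) (r : R) : V -> set (set V) :=
  fun x => [set A | B x A /\ diameter A < r%:E].

End DifferentiationBases.

(* Main.v *)
Require Import Defs.
From mathcomp Require Import all_boot all_order all_algebra.
From mathcomp Require Import finmap.
From mathcomp Require Import all_classical all_reals all_analysis.
From mathcomp Require Import measurable_realfun.
From mathcomp Require Import lra ring zify.
Import Order.TTheory GRing.Theory Num.Theory.
Import numFieldNormedType.Exports.

(** Why the theorem is true.

    Finite Tauberian constants give density.  Let E have finite measure and let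
    U be an open set containing E with |U \ E| small.  Around a point of E the
    sets of small diameter stay in U, so those in which E has density below
    1 - a are sets in which U \ E has density above a; hence the points of E at
    which this happens at every scale lie in a level set of the maximal operator
    applied to the indicator of U \ E, whose measure is at most C |U \ E|
    ([low_density_null_finite]).  Applied to E and to its complement, this yields
    the limit almost everywhere ([tauberian_imp_density]).

    Conversely, assume that for some a the constant is infinite at every scale
    r.  Then for every c there is a set E whose level set H = {M_r 1_E > a}
    satisfies |H| > c |E|.  The heart of the matter is [spread_level_set]:
    translates of E, cut down to a fixed cube of side 4 and of total measure at
    most e, can be chosen so that the corresponding translates of H cover a
    fixed cube Q of side 2 up to measure e.  Given this, take e = 2^-(k+3) and
    r = 1/(k+1) for k = 0, 1, 2 and so on: the union G of all these translates
    has measure at most 1/4, and so has the set of points of Q missed at some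
    stage k.  As |Q| >= 1, a set of positive measure of points outside G is
    left, each contained in sets of the basis of arbitrarily small diameter in
    which G has density above a, contrary to the density property of G
    ([density_imp_tauberian]).

    The translates are found by a greedy choice.  The level set is open because
    the basis is Busemann-Feller, so finitely many lattice cells of side 1/M
    inside it already have total measure above c |E| ([cells_of_open]), and
    translations may be restricted to lattice vectors.  Averaging over
    translations then becomes counting: among all lattice translates of these
    cells, each cell of Q still uncovered occurs as often as H has cells, while
    the lattice translates of E put total mass at most (4M)^(n+1) |E| in the
    cube of side 4.  Some translation therefore covers new cells at a cost per
    cell not above the ratio of these totals; it is used, and the argument is
    repeated with what is left of Q ([greedy_cover]).  Because a translate is
    charged only for its mass in the cube of side 4, the set E can lie anywhere.

    The measure theory on which this rests is developed from the definition of
    the outer measure by boxes: translation invariance, measurability of open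
    sets, outer regularity, and the lower bound for the measure of a cube, the
    last one by compactness and by counting lattice points. *)

Set Implicit Arguments.
Unset Strict Implicit.
Unset Printing Implicit Defensive.

Local Open Scope classical_set_scope.
Local Open Scope ring_scope.
Local Open Scope ereal_scope.

(** * A greedy covering by translates in an abelian group *)

Section GreedyCover.
Variables (Z : zmodType) (K : realFieldType).
Variables (A : seq Z) (cost : Z -> K) (total d : K).
Hypotheses (uA : uniq A) (A0 : (0 < size A)%N).
Hypotheses (cost_ge0 : forall t, (0 <= cost t)%R) (total_ge0 : (0 <= total)%R).
Hypothesis sum_cost :
  forall T, uniq T -> (\sum_(t <- T) cost t <= total)%R.

Let gain (F : seq Z) (t : Z) : nat := count (fun f => (f - t)%R \in A) F.

(** The translates of [A] by all differences [f - a] cover each point of [F]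
    as often as [A] has elements, so the gains add up to [size F * size A]
    while the costs add up to at most [total]: some translate is no worse than
    average. *)
Lemma average_translate (F : seq Z) : uniq F -> (0 < size F)%N ->
  exists2 t, (0 < gain F t)%N &
    (cost t * (size F)%:R * (size A)%:R <= total * (gain F t)%:R)%R.
Proof.
move=> uF F0; pose T := undup [seq (f - a)%R | f <- F, a <- A].
have inT f a : f \in F -> a \in A -> (f - a)%R \in T.
  by move=> fF aA; rewrite mem_undup; apply/allpairsP; exists (f, a).
have sum_gain : (size F * size A <= \sum_(t <- T) gain F t)%N.
  have -> : (\sum_(t <- T) gain F t = \sum_(f <- F)
      count (fun t => (f - t)%R \in A) T)%N.
    under eq_bigr do rewrite /gain -sum1_count big_mkcond.
    rewrite exchange_big; apply: eq_bigr => f _ /=.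
    by rewrite -big_mkcond sum1_count.
  have -> : (size F * size A = \sum_(f <- F) size A)%N.
    by rewrite big_const_seq count_predT iter_addn_0 mulnC.
  rewrite big_seq [leqRHS]big_seq; apply: leq_sum => f fF.
  rewrite -size_filter -(size_map (fun a => (f - a)%R) A).
  apply: uniq_leq_size; first by rewrite map_inj_uniq// => a b /addrI /oppr_inj.
  by move=> _ /mapP[a aA ->]; rewrite mem_filter inT// subKr aA.
have [/hasP[t tT le_t]|/hasPn lt_t] :=
  boolP (has (fun t => cost t * (size F)%:R * (size A)%:R <= total * (gain F t)%:R)%R T).
  exists t => //; rewrite -has_count; apply/hasP.
  move: tT; rewrite mem_undup => /allpairsP[[f a] /= [fF aA ->]].
  by exists f => //; rewrite subKr.
have T0 : has predT T.
  have [f fF] : exists f, f \in F.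
    by case: (F) F0 => // f F' _; exists f; rewrite mem_head.
  have [a aA] : exists a, a \in A.
    by case: (A) A0 => // a A' _; exists a; rewrite mem_head.
  by apply/hasP; exists (f - a)%R => //; exact: inT.
have : (\sum_(t <- T) total * (gain F t)%:R <
        \sum_(t <- T) cost t * (size F)%:R * (size A)%:R)%R.
  rewrite big_seq [ltRHS]big_seq; apply: ltr_sum.
    by case/hasP: T0 => t tT _; apply/hasP; exists t.
  by move=> t /lt_t; rewrite -ltNge.
rewrite -mulr_sumr -!mulr_suml -natr_sum ltNge => /negP[].
rewrite -mulrA -natrM.
apply: (@le_trans _ _ (total * (size F * size A)%:R)%R).
  by rewrite ler_wpM2r// sum_cost ?undup_uniq.
by rewrite ler_wpM2l// ler_nat.
Qed.

(** As long as more than [d] points of [F] are uncovered, a translate of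
    average quality pays at most [total / (size A * d)] for each point that it
    covers, so the whole cost is at most this rate times the number of covered
    points. Each step covers at least one point, hence the process stops. *)
Lemma greedy_cover (F : seq Z) : (0 <= d)%R -> uniq F ->
  exists ts : seq Z,
    let F' := [seq f <- F | all (fun t => (f - t)%R \notin A) ts] in
    ((size F')%:R <= d /\ (\sum_(t <- ts) cost t) * (size A)%:R * d <=
      total * ((size F)%:R - (size F')%:R))%R.
Proof.
move=> d0; have [m] := ubnP (size F); elim: m F => // m IH F Fm uF.
have [Fd|dF] := leP (size F)%:R%R d.
  exists [::]; rewrite /= big_nil !mul0r.
  by rewrite filter_predT subrr mulr0.
have F0 : (0 < size F)%N by rewrite -(ltr_nat K); exact: le_lt_trans dF.
have [t g0 et] := average_translate uF F0.
pose F1 := [seq f <- F | (f - t)%R \notin A].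
have sF : (gain F t + size F1 = size F)%N.
  by rewrite size_filter /gain count_predC.
have [||ts /= [F'd le_ts]] := IH F1.
- by rewrite -ltnS; apply: leq_trans Fm; rewrite ltnS -sF -add1n leq_add2r.
- exact: filter_uniq.
exists (t :: ts); rewrite /=.
have -> : [seq f <- F |
      ((f - t)%R \notin A) && all (fun t => (f - t)%R \notin A) ts]
    = [seq f <- F1 | all (fun t => (f - t)%R \notin A) ts].
  by rewrite /F1 -filter_predI; apply: eq_filter => f /=; rewrite andbC.
split => //; rewrite big_cons -sF natrD.
have : (cost t * (size A)%:R * d <= total * (gain F t)%:R)%R.
  apply: le_trans et; rewrite mulrAC ler_wpM2r// ler_wpM2l// ltW//.
set x := (_%:R) in F'd le_ts *; move: le_ts; rewrite -/x; nra.
Qed.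

End GreedyCover.

Section DensityBases.
Variables (R : realType) (n : nat).
Local Notation V := 'rV[R]_n.+1.
Local Notation L := 'rV[int]_n.+1.
Local Notation mu := (@lebesgue_outer R n).
Implicit Types (A D E U : set V) (c : V * V) (B : V -> set (set V)).

(** * Lebesgue outer measure: boxes, translations, null sets *)

Lemma lebesgue_outer_bigcup (F : nat -> set V) :
  mu (\bigcup_k F k) <= \sum_(k <oo) mu (F k).
Proof. exact: outer_measure_sigma_subadditive. Qed.

Lemma lebesgue_outer_le0 A : mu A <= 0 -> mu A = 0.
Proof. by move=> A0; apply/eqP; rewrite eq_le A0 lebesgue_outer_ge0. Qed.

Lemma lebesgue_measurable_null A : mu A = 0 -> lebesgue_measurable A.
Proof.
move=> A0; apply: le_caratheodory_measurable => X.
rewrite -[leRHS]add0e -A0.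
by apply: leeD; apply: le_lebesgue_outer; [exact: subIsetr|exact: subIsetl].
Qed.

Lemma lebesgue_outer_seq (I : choiceType) (s : seq I) (F : I -> set V) :
  mu (\bigcup_(i in [set` s]) F i) <= \sum_(i <- s) mu (F i).
Proof.
elim: s => [|i s IH].
  by rewrite big_nil set_nil bigcup_set0 lebesgue_outer0.
rewrite big_cons; apply: le_trans (leeD2l _ IH).
apply: le_trans (outer_measureU2 mu _ _); apply: le_lebesgue_outer.
by move=> x [j /=]; rewrite inE => /predU1P[-> |js] Fx; [left|right; exists j].
Qed.

Lemma lebesgue_outer_box c : mu (box c) <= box_volume c.
Proof.
apply: ereal_inf_lbound.
exists (fun k : nat => if k == 0%N then c else (0%R, 0%R)).
  by move=> x cx; exists 0%N.
rewrite nneseries_recl//; last by move=> k _; exact: box_volume_ge0.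
rewrite eseries0 ?adde0// => -[|k] //= _ _.
by rewrite /box_volume big_ord_recl /= subrr maxxx mul0r.
Qed.

Lemma lebesgue_outer_translate (t : V) A :
  mu [set (t + y)%R | y in A] = mu A.
Proof.
have le_tr u X : mu [set (u + y)%R | y in X] <= mu X.
  apply: le_ereal_inf_tmp => _ [c cX <-].
  apply: ereal_inf_lbound.
  exists (fun k => ((u + (c k).1)%R, (u + (c k).2)%R)).
    move=> _ [y Xy <-]; have [k _ ck] := cX _ Xy.
    exists k => // i; have := ck i; rewrite /= !mxE; lra.
  apply: eq_eseriesr => k _; congr _%:E; apply: eq_bigr => i _ /=.
  by rewrite !mxE; congr Num.max; ring.
apply/eqP; rewrite eq_le le_tr /=.
apply: le_trans (le_tr (- t)%R _).
apply: le_lebesgue_outer => y Ay; exists (t + y)%R; first by exists y.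
by rewrite addKr.
Qed.

(** A hyperplane orthogonal to a coordinate axis cuts each box of a cover into
    two boxes whose volumes add up to that of the original box. *)
Lemma lebesgue_measurable_halfspace i s :
  lebesgue_measurable [set x : V | (x ord0 i <= s)%R].
Proof.
apply: le_caratheodory_measurable => X; set H := [set x | _].
apply: le_ereal_inf_tmp => _ [c cX <-].
(* Boxes of the lower and the upper part; one of them is empty when the box
   does not meet the hyperplane. *)
pose lo k : V * V := ((c k).1,
  (\row_j if j == i then Num.min ((c k).2 ord0 j) s else (c k).2 ord0 j)%R).
pose hi k : V * V :=
  ((\row_j if j == i then Num.max ((c k).1 ord0 j) s else (c k).1 ord0 j)%R,
   (c k).2).
have Hlo : mu (X `&` H) <= \sum_(k <oo) box_volume (lo k).
  apply: ereal_inf_lbound; exists lo => // x [Xx Hx].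
  have [k _ ck] := cX _ Xx; exists k => // j; have := ck j.
  by rewrite /= !mxE; case: eqP => // ->; rewrite le_min Hx andbT.
have Hhi : mu (X `&` ~` H) <= \sum_(k <oo) box_volume (hi k).
  apply: ereal_inf_lbound; exists hi => // x [Xx /negP Hx].
  have [k _ ck] := cX _ Xx; exists k => // j; have := ck j.
  rewrite /= !mxE; case: eqP => // ->.
  by rewrite gt_max (ltNge s) Hx andbT.
apply: (le_trans (leeD Hlo Hhi)).
rewrite -nneseriesD; [|by move=> *; exact: box_volume_ge0..].
apply: lee_nneseries => [k _ _|k _].
  by apply: adde_ge0; exact: box_volume_ge0.
rewrite /box_volume -EFinD lee_fin.
rewrite !(bigD1 (P := xpredT) i) //= !mxE !eqxx.
rewrite [X in (_ * X + _)%R](_ : _ = (\prod_(j < n.+1 | j != i)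
   Num.max 0 ((c k).2 ord0 j - (c k).1 ord0 j))%R); last first.
  by apply: eq_bigr => j /negPf ji; rewrite !mxE ji.
rewrite [X in (_ + _ * X)%R](_ : _ = (\prod_(j < n.+1 | j != i)
   Num.max 0 ((c k).2 ord0 j - (c k).1 ord0 j))%R); last first.
  by apply: eq_bigr => j /negPf ji; rewrite !mxE ji.
rewrite -mulrDl ler_wpM2r//.
  by apply: prodr_ge0 => j _; rewrite le_max lexx.
rewrite /Num.max /Num.min; repeat case: ifPn; lra.
Qed.

Lemma lebesgue_measurable_box c : lebesgue_measurable (box c).
Proof.
have -> : box c = \bigcap_i ([set x : V | (x ord0 i <= c.2 ord0 i)%R] `\`
    [set x : V | (x ord0 i <= c.1 ord0 i)%R]).
  apply/seteqP; split => x cx i; have := cx i.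
    by move=> /andP[h1 h2] _; split => //=; apply/negP; rewrite -ltNge.
  by move=> [//|/= h1 /negP]; rewrite -ltNge => ->.
apply: (@fin_bigcap_measurable _ (caratheodory_type mu)) => //.
by move=> i _; apply: measurableD; exact: lebesgue_measurable_halfspace.
Qed.

(** Caratheodory's criterion for the translate, tested on [X], is the one for
    [E] tested on the inverse translate of [X]. *)
Lemma lebesgue_measurable_translate (t : V) E :
  lebesgue_measurable E -> lebesgue_measurable [set (t + y)%R | y in E].
Proof.
move=> mE.
have {}mE : mu.-caratheodory E by exact: mE.
suff : mu.-caratheodory [set (t + y)%R | y in E] by [].
move=> X.
have trI Y : X `&` [set (t + y)%R | y in Y] =
    [set (t + y)%R | y in [set (- t + x)%R | x in X] `&` Y].
  apply/seteqP; split => x.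
    move=> [Xx [y Yy tyx]]; exists y => //; split => //.
    by exists x => //; rewrite -tyx addKr.
  move=> [_ [[z Xz <-] Yz] <-]; rewrite addNKr; split => //.
  by exists (- t + z)%R => //; rewrite addNKr.
have -> : ~` [set (t + y)%R | y in E] = [set (t + y)%R | y in ~` E].
  apply/seteqP; split => x.
    move=> Ex; exists (- t + x)%R; last by rewrite addNKr.
    by move=> Ex'; apply: Ex; exists (- t + x)%R => //; rewrite addNKr.
  by move=> [y Ey <-] [z Ez /addrI zy]; apply: Ey; rewrite -zy.
rewrite !trI !lebesgue_outer_translate -mE.
by rewrite lebesgue_outer_translate.
Qed.

(** * The lattice of mesh 1/M and its cells *)

(** An interval of integral length [k] that is open on the left and closed on
    the right holds at most [k] integers, wherever it lies. *)
Lemma size_lattice (s : seq L) (l : 'I_n.+1 -> R) (k : 'I_n.+1 -> nat) :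
  uniq s ->
  (forall z, z \in s -> forall i, (l i < (z ord0 i)%:~R <= l i + (k i)%:R)%R) ->
  (size s <= \prod_i k i)%N.
Proof.
move=> us sP; case: s us sP => // z0 s us sP.
have k_gt0 i : (0 < k i)%N.
  rewrite lt0n; apply/eqP => k0.
  have := sP z0 (mem_head _ _) i; rewrite k0 addr0 => /andP[l1 l2].
  by have := lt_le_trans l1 l2; rewrite ltxx.
(* The offset of each coordinate from the least admissible integer; the type
   [k.-1.+1] is [k], in a form that is visibly nonempty. *)
pose f (z : L) : {dffun forall i, 'I_(k i).-1.+1} :=
  [ffun i => inord `|(z ord0 i - Num.floor (l i) - 1)%R|%N].
have zk z i : z \in z0 :: s ->
    (Num.floor (l i) < z ord0 i < Num.floor (l i) + 1 + (k i)%:Z)%R.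
  move=> /sP /(_ i) /andP[lz zl]; rewrite floor_lt_int lz /=.
  rewrite -(ltr_int R) intrD; apply: le_lt_trans zl _.
  by rewrite ltrD2r floorD1_gt.
have inord_inj (F a b : int) (m : nat) : (0 < m)%N ->
    (F < a < F + 1 + m%:Z)%R -> (F < b < F + 1 + m%:Z)%R ->
    (inord `|(a - F - 1)%R|%N : 'I_m.-1.+1) = inord `|(b - F - 1)%R|%N -> a = b.
  by move=> m0 Fa Fb /(congr1 val); rewrite /= !inordK; lia.
have f_inj : {in z0 :: s &, injective f}.
  move=> y z ys zs /ffunP fyz; apply/matrixP => i j; rewrite (ord1 i).
  have := fyz j; rewrite !ffunE; apply: inord_inj => //; exact: zk.
apply: (@leq_trans #|{dffun forall i, 'I_(k i).-1.+1}|).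
  rewrite -(size_map f).
  have /card_uniqP <- : uniq (map f (z0 :: s)) by rewrite map_inj_in_uniq.
  exact: max_card.
rewrite card_dep_ffun foldrE big_map big_enum /=; apply: leq_prod => i _.
by rewrite card_ord prednK.
Qed.

Definition lattice_cube (a : int) (k : nat) : seq L :=
  [seq (\row_i (a + (f i : nat)%:Z))%R |
     f : {ffun 'I_n.+1 -> 'I_k} <- enum {ffun 'I_n.+1 -> 'I_k}].

Lemma size_lattice_cube a k : size (lattice_cube a k) = (k ^ n.+1)%N.
Proof. by rewrite size_map -cardT card_ffun !card_ord. Qed.

Lemma lattice_cube_uniq a k : uniq (lattice_cube a k).
Proof.
rewrite map_inj_uniq ?enum_uniq// => f g /matrixP fg.
apply/ffunP => i; have := fg ord0 i; rewrite !mxE => /addrI [fgi].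
exact: val_inj.
Qed.

Lemma mem_lattice_cube a k (z : L) :
  (z \in lattice_cube a k) = [forall i, (a <= z ord0 i < a + k%:Z)%R].
Proof.
apply/mapP/forallP => [[f _ ->] i|zP].
  by rewrite mxE; case: (f i) => m /= mk; rewrite lerDl ltrD2l /= ltz_nat.
have zk i : (`|(z ord0 i - a)%R| < k)%N by have := zP i; lia.
exists [ffun i => Ordinal (zk i)]; first by rewrite mem_enum.
apply/matrixP => i j; rewrite (ord1 i) mxE ffunE /=.
by case/andP: (zP j) => aj _; rewrite gez0_abs ?subr_ge0// addrC subrK.
Qed.

Definition lattice_point (M : nat) (z : L) : V :=
  (\row_i ((z ord0 i)%:~R / M%:R))%R.

Definition cell (M : nat) (z : L) : set V :=
  box (lattice_point M z, lattice_point M (z + const_mx 1)%R).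

(** Cells are open on the left and closed on the right, hence the ceiling. *)
Definition cell_index (M : nat) (x : V) : L :=
  (\row_i (Num.ceil (M%:R * x ord0 i) - 1))%R.

Lemma cellP M z x : (0 < M)%N -> cell M z x <->
  forall i, ((z ord0 i)%:~R < M%:R * x ord0 i <= (z ord0 i)%:~R + 1)%R.
Proof.
move=> M0; have M0' : (0 < M%:R :> R)%R by rewrite ltr0n.
split=> zx i; have := zx i; rewrite /= !mxE.
  by rewrite intrD /= ltr_pdivrMr// ler_pdivlMr// ![(_ * M%:R)%R]mulrC.
by rewrite intrD /= ltr_pdivrMr// ler_pdivlMr// ![(_ * M%:R)%R]mulrC.
Qed.

Lemma cell_index_cell M x : (0 < M)%N -> cell M (cell_index M x) x.
Proof.
move=> M0; apply/cellP => // i; rewrite mxE.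
by have := ceil_itv (M%:R * x ord0 i); rewrite intrD; lra.
Qed.

Lemma cell_translate M t z x : (0 < M)%N ->
  cell M z (x - lattice_point M t)%R <-> cell M (z + t)%R x.
Proof.
move=> M0; have M0' : (M%:R != 0 :> R)%R by rewrite pnatr_eq0 -lt0n.
have E i : (M%:R * (x - lattice_point M t)%R ord0 i =
    M%:R * x ord0 i - (t ord0 i)%:~R)%R.
  by rewrite !mxE mulrBr mulrCA mulfV// mulr1.
split=> /(cellP _ _ M0) zx; apply/(cellP _ _ M0) => i; have := zx i.
  by rewrite E mxE intrD; lra.
by rewrite E mxE intrD; lra.
Qed.

Lemma lebesgue_outer_cell M z : (0 < M)%N ->
  mu (cell M z) <= (M%:R ^- n.+1)%:E.
Proof.
move=> M0; apply: (le_trans (lebesgue_outer_box _)).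
rewrite lee_fin (eq_bigr (fun=> (M%:R^-1)%R)) => [|i _].
  by rewrite prodr_const card_ord exprVn.
rewrite /= !mxE intrD mulrDl addrAC subrr add0r mul1r.
by apply/max_idPr; rewrite invr_ge0.
Qed.

(** * Open sets from inside, boxes from outside *)

Lemma rV_ballP (x y : V) (e : R) : (0 < e)%R ->
  ball x e y <-> forall i, (`|x ord0 i - y ord0 i| < e)%R.
Proof.
move=> e0; split => [[_ xy] i|xy]; first exact: (xy ord0 i).
by split => // i j; rewrite (ord1 i); exact: xy.
Qed.

(** Every lattice cell of side 1/(m+1) through a point of this set lies in
    [U], and the bound on the coordinates leaves only finitely many such
    cells. Unlike the unions of the inner cells for the meshes 1/(m+1), these
    sets increase with [m], which is what continuity of the measure from below
    requires. *)
Definition core U (m : nat) : set V :=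
  box (const_mx (- m%:R)%R, const_mx m%:R) `&`
  [set x | ball x (m.+1%:R^-1)%R `<=` U].

Definition inner_cells U (m : nat) : seq L :=
  [seq z <- lattice_cube (- (m * m.+1)%:Z)%R (2 * m * m.+1)
         | `[< cell m.+1 z `<=` U >]].

Lemma core_sub U m :
  core U m `<=` \bigcup_(z in [set` inner_cells U m]) cell m.+1 z.
Proof.
move=> x [xm xU]; exists (cell_index m.+1 x); last exact: cell_index_cell.
have xc := cell_index_cell x (ltn0Sn m).
have m0 : (0 < m.+1%:R :> R)%R by rewrite ltr0n.
rewrite /= mem_filter; apply/andP; split.
  apply/asboolP => y /cellP yc; apply: xU.
  apply/rV_ballP; rewrite ?invr_gt0// => i.
  rewrite -div1r ltr_pdivlMr// mulrC -[X in (X * _)%R]gtr0_norm// -normrM mulrBr.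
  have := yc isT i; move/cellP : xc => /(_ isT i).
  by rewrite ltr_norml; lra.
rewrite mem_lattice_cube; apply/forallP => i.
have := xm i; rewrite /= !mxE => /andP[xm1 xm2].
have H1 : (Num.ceil (m.+1%:R * x ord0 i) <= (m * m.+1)%:Z)%R.
  by rewrite ceil_le_int -pmulrn natrM mulrC ler_pM2r.
have H2 : (- (m * m.+1)%:Z < Num.ceil (m.+1%:R * x ord0 i))%R.
  by rewrite ceil_gt_int intrN -pmulrn natrM mulrC -mulrN ltr_pM2l.
by move: (Num.ceil _) H1 H2 => q; lia.
Qed.

Lemma inner_cells_sub U m :
  \bigcup_(z in [set` inner_cells U m]) cell m.+1 z `<=` U.
Proof.
by move=> x [z /=]; rewrite mem_filter => /andP[/asboolP zU _]; exact: zU.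
Qed.

Lemma core_nondecreasing U : {homo core U : k m / (k <= m)%N >-> k `<=` m}.
Proof.
move=> k m km x [xk xU]; split => [i|y xy].
  have := xk i; rewrite /= !mxE => /andP[h1 h2].
  have km' : (k%:R <= m%:R :> R)%R by rewrite ler_nat.
  by apply/andP; split; lra.
apply: xU; apply: le_ball xy.
by rewrite lef_pV2 ?posrE ?ltr0n// ler_nat.
Qed.

Lemma bigcup_core U : open U -> \bigcup_m core U m = U.
Proof.
move=> oU; apply/seteqP; split => [x [m _ [_ xU]]|x Ux].
  by apply: xU; apply: ballxx; rewrite invr_gt0 ltr0n.
have [e /= e0 xU] : exists2 e : R, (0 < e)%R & ball x e `<=` U.
  have : nbhs x U by exact: open_nbhs_nbhs.
  by move=> /nbhs_ballP[e e0 xU]; exists e.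
(* The first term makes 1/(m+1) smaller than e, the others bound each
   coordinate of x by m. *)
pose m := (Num.truncn e^-1 + \sum_i (Num.truncn `|x ord0 i|).+1)%N.
exists m => //; split => [i|y].
  have xi : (`|x ord0 i| < m%:R)%R.
    apply: lt_le_trans (truncnS_gt _) _.
    rewrite ler_nat /m (bigD1 i)//= addnCA.
    exact: leq_addr.
  rewrite /= !mxE; move: xi; rewrite ltr_norml => /andP[-> /ltW ->] //.
move=> xy; apply: xU; apply: le_ball xy.
rewrite -[leRHS]invrK lef_pV2 ?posrE ?ltr0n ?invr_gt0//.
apply/ltW/(lt_le_trans (truncnS_gt _)).
by rewrite ler_nat ltnS leq_addr.
Qed.

Lemma lebesgue_measurable_open U : open U -> lebesgue_measurable U.
Proof.
move=> oU.
have -> : U = \bigcup_m \bigcup_(z in [set` inner_cells U m]) cell m.+1 z.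
  apply/seteqP; split => [x|x [m _]]; last exact: inner_cells_sub.
  by rewrite -{1}(bigcup_core oU) => -[m _ /core_sub ?]; exists m.
apply: (@bigcupT_measurable _ (caratheodory_type mu)) => m.
apply: (@fin_bigcup_measurable _ (caratheodory_type mu)) => // z _.
exact: lebesgue_measurable_box.
Qed.

(** Up to a box this is a closed set: its complement is the union of the balls
    centred outside [U]. *)
Lemma lebesgue_measurable_core U m : lebesgue_measurable (core U m).
Proof.
apply: (@measurableI _ (caratheodory_type mu)).
  exact: lebesgue_measurable_box.
rewrite -[X in measurable X]setCK.
apply: (@measurableC _ (caratheodory_type mu)).
apply: lebesgue_measurable_open.
have e0 : (0 < m.+1%:R^-1 :> R)%R by rewrite invr_gt0 ltr0n.
rewrite [X in open X](_ : _ = \bigcup_(y in ~` U) ball y (m.+1%:R^-1)%R).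
  by apply: bigcup_open => y _; exact: ball_open.
apply/seteqP; split => [x /= /existsNP[y /not_implyP[xy Uy]]|x [y Uy yx] /= xU].
  by exists y => //; exact: ball_sym.
by apply: Uy; apply: xU; exact: ball_sym.
Qed.

Lemma lebesgue_gt_core U (a : \bar R) : open U -> a < mu U ->
  exists m, a < mu (core U m).
Proof.
move=> oU aU; apply: contrapT => /forallNP na.
have : @lebesgue R n \o core U @ \oo --> @lebesgue R n (\bigcup_m core U m).
  apply: nondecreasing_cvg_mu.
  - by move=> m; exact: lebesgue_measurable_core.
  - by rewrite bigcup_core//; exact: lebesgue_measurable_open.
  - by move=> k m km; apply/subsetPset; exact: core_nondecreasing.
rewrite bigcup_core// => cU.
suff : mu U <= a by rewrite leNgt aU.
apply: (cvge_to_le cU); near=> m.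
by have /negP := na m; rewrite -leNgt.
Unshelve. all: by end_near. Qed.

Definition obox c : set V :=
  [set x | forall i, (c.1 ord0 i < x ord0 i < c.2 ord0 i)%R].

Lemma obox_open c : open (obox c).
Proof.
rewrite openE => x cx; rewrite /interior.
apply: (@filter_forall _ _
  (fun i (y : V) => is_true (c.1 ord0 i < y ord0 i < c.2 ord0 i)%R) (nbhs x)
  (nbhs_filter x)) => i.
have /andP[x1 x2] := cx i.
have xc := @coord_continuous R 1 n.+1 ord0 i x.
near=> y; apply/andP; split; near: y.
  exact: (cvgr_gt _ xc).
exact: (cvgr_lt _ xc).
Unshelve. all: by end_near. Qed.

Lemma obox_sub c : obox c `<=` box c.
Proof. by move=> x cx i; have /andP[-> /ltW] := cx i. Qed.

Lemma cvg_prod_add (w : 'I_n.+1 -> R) :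
  (\prod_(i < n.+1) (w i + M.+1%:R^-1))%R @[M --> \oo] --> (\prod_(i < n.+1) w i)%R.
Proof.
apply: (@cvg_big R) => //; first exact: mul_continuous.
move=> i _; rewrite -[X in _ --> X]addr0; apply: cvgD; first exact: cvg_cst.
exact: cvg_harmonic.
Unshelve. all: by end_near. Qed.

(** * Outer regularity and the measure of a cube *)

Lemma enlarge_box c (e : R) : (0 < e)%R ->
  exists c', box c `<=` obox c' /\ box_volume c' <= box_volume c + e%:E.
Proof.
move=> e0; pose w i : R := Num.max 0%R (c.2 ord0 i - c.1 ord0 i)%R.
have [M _ /(_ M (leqnn M)) /= Me] : \forall M \near \oo,
    (\prod_(i < n.+1) (w i + M.+1%:R^-1) <= (\prod_(i < n.+1) w i) + e)%R.
  by apply: (cvgr_le _ (@cvg_prod_add w)); rewrite ltrDl.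
have M0 : (0 < M.+1%:R^-1 :> R)%R by rewrite invr_gt0 ltr0n.
exists (c.1, c.2 + const_mx M.+1%:R^-1)%R; split.
  move=> x cx i; have /andP[x1 x2] := cx i.
  by rewrite /= !mxE x1 /=; apply: le_lt_trans x2 _; rewrite ltrDl.
rewrite /box_volume -EFinD lee_fin; apply: le_trans Me.
apply: ler_prod => i _; rewrite le_max lexx /= !mxE ge_max.
have w0 : (0 <= w i)%R by rewrite le_max lexx.
have cw : (c.2 ord0 i - c.1 ord0 i <= w i)%R by rewrite le_max lexx orbT.
by rewrite addr_ge0 ?(ltW M0)//= addrAC lerD2r.
Qed.

(** Half-open boxes of a cover are replaced by open ones, at the price of [e]:
    outer regularity and the extraction of finite subcovers both need this. *)
Lemma enlarge_cover (c : nat -> V * V) (e : R) : (0 < e)%R ->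
  exists c' : nat -> V * V, (forall k, box (c k) `<=` obox (c' k)) /\
    \sum_(k <oo) box_volume (c' k) <= \sum_(k <oo) box_volume (c k) + e%:E.
Proof.
move=> e0.
have /choice[c' c'P] : forall k, exists d, box (c k) `<=` obox d /\
    box_volume d <= box_volume (c k) + (e / (2 ^ k.+1)%:R)%:E.
  by move=> k; apply: enlarge_box; rewrite divr_gt0// ltr0n expn_gt0.
exists c'; split; first by move=> k; have [] := c'P k.
apply: (@le_trans _ _ (\sum_(k <oo) (box_volume (c k) + (e / (2 ^ k.+1)%:R)%:E))).
  apply: lee_nneseries => [k _ _|k _]; first exact: box_volume_ge0.
  by have [] := c'P k.
by apply: (epsilon_trick xpredT); [move=> k; exact: box_volume_ge0|exact: ltW].
Qed.

Lemma lebesgue_outer_regular E (e : R) : mu E < +oo -> (0 < e)%R ->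
  exists U, [/\ open U, E `<=` U & mu U <= mu E + e%:E].
Proof.
move=> Eoo e0.
have Efin : mu E \is a fin_num by rewrite ge0_fin_numE ?lebesgue_outer_ge0.
have e2 : (0 < e / 2)%R by rewrite divr_gt0.
have [_ [c Ec <-] /ltW cE] := lb_ereal_inf_adherent e2 Efin.
have [c' [cc' c'E]] := enlarge_cover c e2.
exists (\bigcup_k obox (c' k)); split.
- by apply: bigcup_open => k _; exact: obox_open.
- by move=> x /Ec[k _ /cc' xk]; exists k.
- rewrite [e]splitr EFinD addeA.
  apply: le_trans (le_trans c'E (leeD2r _ cE)).
  apply: ereal_inf_lbound; exists c' => // x [k _ /obox_sub xk]; by exists k.
Qed.

(** An open interval of length [w] contains at most [M w + 1] multiples of
    1/M. The factor M^(n+1) is kept apart, so that M can tend to infinity in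
    the rest. *)
Lemma size_lattice_box c (M : nat) (s : seq L) : uniq s ->
  (forall z, z \in s -> obox c (lattice_point M.+1 z)) ->
  ((size s)%:R <= M.+1%:R ^+ n.+1 * \prod_(i < n.+1)
     (Num.max 0 (c.2 ord0 i - c.1 ord0 i) + M.+1%:R^-1) :> R)%R.
Proof.
move=> us sc; pose w i : R := Num.max 0%R (c.2 ord0 i - c.1 ord0 i)%R.
have M0 : (0 < M.+1%:R :> R)%R by rewrite ltr0n.
have w0 i : (0 <= w i)%R by rewrite le_max lexx.
pose k i := (Num.truncn (M.+1%:R * w i)).+1.
have sk : (size s <= \prod_(i < n.+1) k i)%N.
  apply: (@size_lattice s (fun i => M.+1%:R * c.1 ord0 i)%R k us) => z zs i.
  have := sc z zs i; rewrite mxE ltr_pdivlMr// ltr_pdivrMr//.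
  rewrite ![(_ * M.+1%:R)%R]mulrC => /andP[-> /ltW zc] /=.
  apply: le_trans zc _; rewrite -lerBlDl -mulrBr.
  apply/ltW/(le_lt_trans _ (truncnS_gt _)).
  by rewrite ler_pM2l// le_max lexx orbT.
rewrite -[X in (_ ^+ X)%R]card_ord -prodr_const -big_split /=.
apply: (@le_trans _ _ (\prod_(i < n.+1) k i)%:R); first by rewrite ler_nat.
rewrite natr_prod; apply: ler_prod => i _; rewrite ler0n /=.
rewrite mulrDr mulfV ?gt_eqF// -/(w i) /k -natr1 lerD2r.
by rewrite truncn_le mulr_ge0// ltW.
Qed.

Definition cube2 : set V := box (const_mx 0%R, const_mx 2%R).

(** Counting lattice points bounds volumes from below: finitely many open
    boxes covering the compact cube [1, 2]^(n+1) contain the M^(n+1) lattice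
    points of [1, 2)^(n+1), and dividing by M^(n+1) and letting M tend to
    infinity shows that their volumes add up to at least 1. *)
Lemma lebesgue_outer_cube2 : 1 <= mu cube2.
Proof.
apply: le_ereal_inf_tmp => _ [c Qc <-]; apply/lee_addgt0Pr => e e0.
have [c' [cc' c'E]] := enlarge_cover c e0; apply: le_trans c'E.
pose P := [set v : V | forall i, `[1%R, 2%R]%classic (v ord0 i)].
have : compact P.
  apply: (@rV_compact R n.+1 (fun=> `[1%R, 2%R]%classic)) => i.
  exact: segment_compact.
rewrite compact_cover => /(_ nat setT (fun k => obox (c' k))) [||D _ PD].
- by move=> k _; exact: obox_open.
- move=> x Px; have [|k _ /cc' xk] := Qc x; last by exists k.
  by move=> i; have := Px i; rewrite /= !mxE in_itv /=; lra.
pose w k i : R := Num.max 0%R ((c' k).2 ord0 i - (c' k).1 ord0 i)%R.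
apply: le_trans (lee_sum_fset_lim D xpredT _); last first.
  by move=> k _; exact: box_volume_ge0.
rewrite sumEFin lee_fin.
have : (\sum_(k <- D) \prod_(i < n.+1) (w k i + M.+1%:R^-1))%R @[M --> \oo]
    --> (\sum_(k <- D) \prod_(i < n.+1) w k i)%R.
  apply: (@cvg_big R) => //; first exact: add_continuous.
  by move=> k _; exact: cvg_prod_add.
move/cvgr_to_ge; apply; near=> M.
have M0 : (0 < M.+1%:R ^+ n.+1 :> R)%R by rewrite exprn_gt0// ltr0n.
pose s := lattice_cube M.+1%:Z M.+1.
rewrite -(ler_pM2l M0) mulr1 mulr_sumr -natrX -(size_lattice_cube M.+1%:Z).
have sD z : z \in s -> exists2 k, k \in D & obox (c' k) (lattice_point M.+1 z).
  rewrite mem_lattice_cube => /forallP zM.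
  apply: PD => i; rewrite /= in_itv /= !mxE.
  rewrite ler_pdivlMr ?ler_pdivrMr ?ltr0n// mul1r.
  have := zM i; rewrite -!(ler_int R) -(ltr_int R) intrD -!pmulrn => /andP[-> /ltW].
  by rewrite mulrDl mul1r.
apply: (@le_trans _ _ (\sum_(k <- D) (size [seq z <- s |
    `[< obox (c' k) (lattice_point M.+1 z) >]])%:R)%R); last first.
  apply: ler_sum => k _; rewrite size_lattice_cube natrX; apply: size_lattice_box.
    by rewrite filter_uniq// lattice_cube_uniq.
  by move=> z; rewrite mem_filter => /andP[/asboolP].
rewrite -natr_sum ler_nat -/s.
under eq_bigr do rewrite size_filter -sum1_count big_mkcond.
rewrite exchange_big /= -sum1_size big_seq [leqRHS]big_seq.
apply: leq_sum => z /sD[k kD zk].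
rewrite (bigD1_seq k)//= ?finmap.fset_uniq//.
by case: asboolP => // _; rewrite leq_addr.
Unshelve. all: by end_near. Qed.

(** * Positivity of open sets, and averages *)

Lemma cube2_cells M : (0 < M)%N ->
  cube2 `<=` \bigcup_(z in [set` lattice_cube 0 (2 * M)]) cell M z.
Proof.
move=> M0 x xQ; exists (cell_index M x); last exact: cell_index_cell.
rewrite /= mem_lattice_cube; apply/forallP => i.
have M0' : (0 < M%:R :> R)%R by rewrite ltr0n.
have := xQ i; rewrite /= !mxE => /andP[x0 x2].
have H1 : (Num.ceil (M%:R * x ord0 i) <= (2 * M)%:Z)%R.
  by rewrite ceil_le_int -pmulrn natrM mulrC ler_pM2r.
have H2 : (0 < Num.ceil (M%:R * x ord0 i))%R.
  by rewrite ceil_gt0 mulr_gt0.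
by move: (Num.ceil _) H1 H2 => q; lia.
Qed.

(** The set contains a cell; if that cell were null then so would be its
    translates, finitely many of which cover a cube of positive measure. *)
Lemma lebesgue_outer_open_gt0 U : open U -> U !=set0 -> 0 < mu U.
Proof.
move=> oU [x0 Ux0].
have [m _ /core_sub [z /= zU _]] : (\bigcup_m core U m) x0 by rewrite bigcup_core.
have M0 := ltn0Sn m.
have cellU : cell m.+1 z `<=` U.
  by move=> y zy; apply: (@inner_cells_sub _ m); exists z.
apply: lt_le_trans (le_lebesgue_outer cellU).
have cellE y : mu (cell m.+1 y) = mu (cell m.+1 z).
  rewrite -[RHS](lebesgue_outer_translate (lattice_point m.+1 (y - z)%R)).
  congr (mu _); apply/seteqP; split => [x xy|_ [x xz <-]].
    exists (x - lattice_point m.+1 (y - z))%R; last by rewrite addrC subrK.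
    by apply/cell_translate => //; rewrite addrC subrK.
  suff : cell m.+1 (z + (y - z))%R (lattice_point m.+1 (y - z) + x)%R.
    by rewrite subrKC.
  by apply/cell_translate => //; rewrite addrAC subrr add0r.
rewrite lt0e lebesgue_outer_ge0 andbT; apply/eqP => z0.
have := lebesgue_outer_cube2; rewrite leNgt => /negP; apply.
apply: (le_lt_trans (le_lebesgue_outer (cube2_cells M0))).
apply: (le_lt_trans (lebesgue_outer_seq _ _)).
by rewrite big1// => y _; rewrite cellE.
Qed.

Lemma lebesgue_outer_bounded A : bounded_set A -> mu A < +oo.
Proof.
move=> [K [_ AK]].
pose k : R := (`|K| + 1)%R.
have {}AK x : A x -> (`|x| <= k)%R.
  by apply: AK; rewrite /k; have := ler_norm K; lra.
apply: (@le_lt_trans _ _ (mu (box (const_mx (- k - 1)%R, const_mx k)))).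
  apply: le_lebesgue_outer => x /AK xk i.
  have : (`|x ord0 i| <= k)%R.
    apply: le_trans xk; rewrite /Num.norm /= mx_normrE.
    exact: (le_bigmax _ (fun ij : 'I_1 * 'I_n.+1 => `|x ij.1 ij.2|%R) (ord0, i)).
  by rewrite /= !mxE ler_norml; lra.
exact: le_lt_trans (lebesgue_outer_box _) (ltry _).
Qed.

Lemma average_indic A E : lebesgue_measurable A -> lebesgue_measurable E ->
  average A (\1_E : V -> R) = (mu A)^-1 * mu (A `&` E).
Proof.
move=> mA mE; rewrite /average.
by rewrite (@integral_indic _ (caratheodory_type mu) R (@lebesgue R n) A mA E mE) setIC.
Qed.

Lemma maximal_operator_indic (B : V -> set (set V)) E x :
  maximal_operator B (\1_E : V -> R) x =
  ereal_sup [set average A (\1_E : V -> R) | A in B x].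
Proof.
congr ereal_sup; apply: eq_imagel => A _; congr (average A _).
by apply/funext => y; rewrite ger0_norm// indicE ler0n.
Qed.

(** Integrate over [E] the number of sets [F t] containing a given point. *)
Lemma sum_measure_overlap (I : choiceType) (T : seq I) (F : I -> set V) E k :
  lebesgue_measurable E -> (forall t, lebesgue_measurable (F t)) ->
  (forall x, (size [seq t <- T | `[< F t x >]] <= k)%N) ->
  \sum_(t <- T) mu (E `&` F t) <= k%:R%:E * mu E.
Proof.
move=> mE mF Tk.
have mFE t : measurable_fun (E : set (caratheodory_type mu))
    (fun x => (\1_(F t) x)%:E : \bar R).
  apply/measurable_EFinP.
  exact: (@measurable_indic _ (caratheodory_type mu) R E (F t) (mF t)).
have -> : \sum_(t <- T) mu (E `&` F t) = 
    \sum_(t <- T) \int[@lebesgue R n]_(x in E) (\1_(F t) x)%:E.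
  apply: eq_bigr => t _; rewrite setIC.
  by rewrite (@integral_indic _ (caratheodory_type mu) R _ E mE _ (mF t)).
rewrite -ge0_integral_sum//.
rewrite -[mu E]/(@lebesgue R n E) -integral_cst//.
apply: ge0_le_integral => //.
- by move=> x _; apply: sume_ge0 => t _; rewrite lee_fin.
- by apply: emeasurable_sum => t; exact: mFE.
move=> x _; rewrite sumEFin lee_fin.
apply: (@le_trans _ _ (size [seq t <- T | `[< F t x >]])%:R); last by rewrite ler_nat.
rewrite size_filter -sum1_count natr_sum [leRHS]big_mkcond /=.
apply: ler_sum => t _; rewrite indicE.
by case: asboolP => Ft; [rewrite mem_set|rewrite memNset].
Qed.

(** * Level sets of maximal operators *)

Lemma lt_diameter_coord A (e : R) x y : diameter A < e%:E -> A x -> A y ->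
  forall i, (`|x ord0 i - y ord0 i| < e)%R.
Proof.
move=> dA Ax Ay i; rewrite -lte_fin; apply: le_lt_trans dA.
apply: le_trans (ereal_sup_ubound _); last by exists x => //; exists y.
rewrite lee_fin -sqrtr_sqr; apply: ler_wsqrtr.
rewrite (bigD1 i)//= !mxE lerDl.
by apply: sumr_ge0 => j _; exact: sqr_ge0.
Qed.

Lemma diameter_ge0 A : A !=set0 -> 0 <= diameter A.
Proof.
move=> [x Ax]; apply: le_trans (ereal_sup_ubound _); last first.
  by exists x => //; exists x.
by rewrite lee_fin sqrtr_ge0.
Qed.

Lemma diameter_translate (t : V) A : diameter [set (t + y)%R | y in A] = diameter A.
Proof.
congr ereal_sup; apply/seteqP; split.
  move=> _ [_ [x Ax <-] [_ [y Ay <-] <-]]; exists x => //; exists y => //.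
  by rewrite [in RHS]opprD addrACA subrr add0r.
move=> _ [x Ax [y Ay <-]]; exists (t + x)%R; first by exists x.
exists (t + y)%R; first by exists y.
by rewrite opprD addrACA subrr add0r.
Qed.

(** A set at [x] and its translate at [t + x] are translates of the same set
    at the origin. *)
Lemma translate_basis B t x A : translation_invariant B ->
  B x A -> B (t + x)%R [set (t + y)%R | y in A].
Proof.
move=> TI BA; pose A0 := [set (- x + a)%R | a in A].
have trA u : [set (u + x + y)%R | y in A0] = [set (u + y)%R | y in A].
  apply/seteqP; split=> [_ [_ [a Aa <-] <-]|_ [a Aa <-]].
    by exists a => //; rewrite addrA addrK.
  by exists (- x + a)%R; [exists a|rewrite addrA addrK].
rewrite -trA; apply/(TI (t + x)%R)/(TI x).
have -> : [set (x + y)%R | y in A0] = A.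
  have := trA 0%R; rewrite add0r => ->.
  by under eq_fun do rewrite add0r; rewrite image_id.
by [].
Qed.

Lemma lt_maximal_operatorP B E x (a : R) :
  a%:E < maximal_operator B (\1_E : V -> R) x <->
  exists2 A, B x A & a%:E < average A (\1_E : V -> R).
Proof.
rewrite maximal_operator_indic; split.
  by move=> /ereal_sup_gt[_ [A BA <-] aA]; exists A.
move=> [A BA aA]; apply: (lt_le_trans aA).
by apply: ereal_sup_ubound; exists A.
Qed.

(** In a Busemann-Feller basis a set witnessing a large value of the maximal
    operator at one of its points is a witness at all of its points, and it is
    open. *)
Lemma open_level_set B E (a r : R) : busemann_feller_basis B ->
  open [set x | a%:E < maximal_operator (truncated_basis B r) (\1_E : V -> R) x].
Proof.
move=> [dB BF]; rewrite openE => x /lt_maximal_operatorP[A [BA dA] aA].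
have [_ /(_ A BA)[_ oA Ax] _] := dB x.
rewrite /interior; have : nbhs x A by exact: open_nbhs_nbhs.
apply: filterS => y Ay; apply/lt_maximal_operatorP.
by exists A => //; split => //; exact: BF BA.
Qed.

(** * A large Tauberian constant spreads over a cube *)

(** The strict inequality leaves room for replacing the open set by finitely
    many cells of a fine enough lattice. *)
Lemma cells_of_open U (a : \bar R) : open U -> a < mu U ->
  exists2 M, (0 < M)%N & exists A : seq L, [/\ uniq A,
    forall z, z \in A -> cell M z `<=` U &
    a < ((size A)%:R / M%:R ^+ n.+1)%:E].
Proof.
move=> oU /(lebesgue_gt_core oU)[m am]; exists m.+1 => //.
exists (inner_cells U m); split.
- by rewrite filter_uniq// lattice_cube_uniq.
- by move=> z zU x zx; apply: (@inner_cells_sub _ m); exists z.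
apply: (lt_le_trans am); apply: (le_trans (le_lebesgue_outer (@core_sub _ _))).
apply: (le_trans (lebesgue_outer_seq _ _)).
apply: (@le_trans _ _ (\sum_(z <- inner_cells U m) (m.+1%:R ^- n.+1)%:E)).
  by apply: lee_sum => z _; exact: lebesgue_outer_cell.
rewrite sumEFin lee_fin big_const_seq count_predT iter_addr_0.
by rewrite mulr_natl.
Qed.

Definition cube4 : set V := box (const_mx (- 1)%R, const_mx 3%R).

(** A point [x] lies in the translate of [cube4] by [- t / M] exactly when [t]
    is in a cube of side [4 * M], so each point of [E] is counted at most
    (4M)^(n+1) times. *)
Lemma sum_translates_cube4 E M (T : seq L) : (0 < M)%N ->
  lebesgue_measurable E -> uniq T ->
  \sum_(t <- T) mu ([set (lattice_point M t + y)%R | y in E] `&` cube4) <=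
    ((4 * M)%:R ^+ n.+1)%:E * mu E.
Proof.
move=> M0 mE uT.
(* Moving the mass back to [E] turns translates of [E] in one cube into parts of
   [E] in translated cubes. *)
pose F t : set V := [set (- lattice_point M t + y)%R | y in cube4].
have -> : \sum_(t <- T) mu ([set (lattice_point M t + y)%R | y in E] `&` cube4)
    = \sum_(t <- T) mu (E `&` F t).
  apply: eq_bigr => t _.
  rewrite -[RHS](lebesgue_outer_translate (lattice_point M t)).
  congr (mu _); apply/seteqP; split => [_ [[x Ex <-] xc]|_ [x [Ex [y yc yx]] <-]].
    by exists x => //; split => //; exists (lattice_point M t + x)%R; rewrite ?addKr.
  by split; [exists x|rewrite -yx addNKr].
rewrite -natrX; apply: sum_measure_overlap => //.
  move=> t; apply: lebesgue_measurable_translate; exact: lebesgue_measurable_box.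
move=> x.
rewrite (_ : (4 * M) ^ n.+1 = \prod_(i < n.+1) (4 * M))%N; last first.
  by rewrite prod_nat_const card_ord.
apply: (@size_lattice _ (fun i => M%:R * (- 1 - x ord0 i))%R).
  exact: filter_uniq.
move=> t; rewrite mem_filter => /andP[/asboolP[y yc yx] _] i.
have M0' : (0 < M%:R :> R)%R by rewrite ltr0n.
have := yc i; rewrite /= !mxE.
have -> : (y ord0 i = x ord0 i + (t ord0 i)%:~R / M%:R)%R.
  by rewrite -yx !mxE addrAC addNr add0r.
move=> /andP[y1 y2]; apply/andP; split.
  by rewrite mulrC -ltr_pdivlMr//; lra.
by rewrite natrM [(4 * _)%R]mulrC -mulrDr mulrC -ler_pdivrMr//; lra.
Qed.

(** Put c = 8^(n+1) / e^2 and take E with |H| > c |E|, filled by more than c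
    |E| M^(n+1) cells. The greedy covering of the (2M)^(n+1) cells of [cube2],
    with (4M)^(n+1) |E| for the total of the costs, is stopped when at most e
    M^(n+1) cells are left. In its cost the powers of M and the factor |E|
    cancel, which leaves at most 8^(n+1) / (c e) = e. *)
Lemma spread_level_set B (a r e : R) : busemann_feller_basis B ->
  translation_invariant B -> (0 < r <= 1)%R -> (0 < e)%R ->
  tauberian_constant (truncated_basis B r) a = +oo ->
  exists G U, [/\ lebesgue_measurable G, mu G <= e%:E, mu U <= e%:E &
    forall x, cube2 x -> ~ U x -> exists A, [/\ B x A, diameter A < r%:E &
      a%:E < average A (\1_G : V -> R)]].
Proof.
move=> BF TI /andP[r0 r1] e0 tau.
pose c : R := (8 ^+ n.+1 / e ^+ 2)%R.
have c0 : (0 < c)%R by rewrite divr_gt0// exprn_gt0.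
have [E [mE E0 Eoo cE]] : exists E, [/\ lebesgue_measurable E, 0 < mu E,
    mu E < +oo & c%:E * mu E < mu [set x |
      a%:E < maximal_operator (truncated_basis B r) (\1_E : V -> R) x]].
  have : c%:E < tauberian_constant (truncated_basis B r) a by rewrite tau ltry.
  move=> /ereal_sup_gt[_ [E [mE /andP[E0 Eoo]] <-] cE]; exists E; split => //.
  have Ev : mu E = (fine (mu E))%:E.
    by rewrite fineK// ge0_fin_numE ?lebesgue_outer_ge0.
  have v0 : (0 < fine (mu E))%R by apply: fine_gt0; rewrite E0.
  move: cE; rewrite /lebesgue Ev inver gt_eqF// lte_pdivlMl//.
  by rewrite muleC.
set H := [set x | _] in cE.
have oH : open H by exact: open_level_set.
have [M M0 [A [uA AH cA]]] := cells_of_open oH cE.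
have Efin : mu E \is a fin_num by rewrite ge0_fin_numE ?lebesgue_outer_ge0.
pose v := fine (mu E).
have v0 : (0 < v)%R by apply: fine_gt0; rewrite E0.
have Ev : mu E = v%:E by rewrite fineK.
rewrite Ev -EFinM lte_fin in cA.
have MN0 : (0 < M%:R ^+ n.+1 :> R)%R by rewrite exprn_gt0// ltr0n.
rewrite ltr_pdivlMr// in cA.
pose Et t : set V := [set (lattice_point M t + y)%R | y in E] `&` cube4.
have mEt t : lebesgue_measurable (Et t).
  apply: (@measurableI _ (caratheodory_type mu)).
    exact: lebesgue_measurable_translate.
  exact: lebesgue_measurable_box.
have Etfin t : mu (Et t) \is a fin_num.
  rewrite ge0_fin_numE ?lebesgue_outer_ge0//.
  apply: le_lt_trans Eoo; rewrite -[leRHS](lebesgue_outer_translate (lattice_point M t)).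
  by apply: le_lebesgue_outer; exact: subIsetl.
pose cost t := fine (mu (Et t)).
pose S : R := ((4 * M)%:R ^+ n.+1 * v)%R.
have A0 : (0 < size A)%N.
  by rewrite -(ltr0n R); apply: lt_trans cA; rewrite mulr_gt0// mulr_gt0.
have sum_cost (T : seq L) : uniq T -> (\sum_(t <- T) cost t <= S)%R.
  move=> uT; rewrite -lee_fin /S EFinM -Ev -sumEFin.
  rewrite (eq_bigr (fun t => mu (Et t))) => [|t _]; last by rewrite fineK.
  exact: sum_translates_cube4.
pose d : R := (e * M%:R ^+ n.+1)%R.
have d0 : (0 < d)%R by rewrite mulr_gt0.
pose F := lattice_cube 0 (2 * M).
have [||||ts /= [F'd ts_cost]] := @greedy_cover _ R A cost S d uA A0 _ _ sum_cost F.
- by move=> t; rewrite fine_ge0 ?lebesgue_outer_ge0.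
- by rewrite /S mulr_ge0// ltW.
- exact: ltW.
- exact: lattice_cube_uniq.
set F' := [seq f <- F | _] in F'd ts_cost.
exists (\bigcup_(t in [set` ts]) Et t), (\bigcup_(z in [set` F']) cell M z).
have mG : lebesgue_measurable (\bigcup_(t in [set` ts]) Et t).
  apply: (@fin_bigcup_measurable _ (caratheodory_type mu)) => // t _.
  exact: mEt.
split => //.
- apply: (le_trans (lebesgue_outer_seq _ _)).
  rewrite (eq_bigr (fun t => (cost t)%:E)) => [|t _]; last by rewrite fineK.
  rewrite sumEFin lee_fin; set s := (\sum_(t <- ts) _)%R in ts_cost *.
  pose m : R := (M%:R ^+ n.+1)%R; rewrite -/m in MN0 cA.
  have : (s * (size A)%:R * d <= S * (size F)%:R)%R.
    apply: le_trans ts_cost _; rewrite ler_wpM2l ?gerBl ?ler0n//.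
    by rewrite /S mulr_ge0// ltW.
  rewrite /S /F size_lattice_cube /d !natrX !natrM !exprMn -/m => sA.
  have {}sA : (s * (size A)%:R * e <= 8 ^+ n.+1 * v * m)%R.
    rewrite -(ler_pM2r MN0) -[leLHS]mulrA; apply: le_trans sA _.
    rewrite (_ : 8 = 4 * 2)%R ?exprMn; last by ring.
    by rewrite le_eqVlt; apply/orP; left; apply/eqP; ring.
  have {}cA : (8 ^+ n.+1 * v * m < (size A)%:R * e ^+ 2)%R.
    rewrite -ltr_pdivrMr ?exprn_gt0//; apply: le_lt_trans cA.
    by rewrite le_eqVlt; apply/orP; left; apply/eqP; rewrite /c; ring.
  rewrite leNgt; apply/negP => es.
  have : ((size A)%:R * e ^+ 2 < (size A)%:R * e ^+ 2)%R.
    apply: le_lt_trans (le_lt_trans sA cA).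
    by rewrite expr2 mulrA [(s * _)%R]mulrC -2!mulrA ler_wpM2l// ler_wpM2r// ltW.
  by rewrite ltxx.
- apply: (le_trans (lebesgue_outer_seq _ _)).
  apply: (@le_trans _ _ (\sum_(z <- F') (M%:R ^- n.+1)%:E)).
    by apply: lee_sum => z _; exact: lebesgue_outer_cell.
  rewrite sumEFin lee_fin big_const_seq count_predT iter_addr_0.
  by rewrite -[leLHS]mulr_natl ler_pdivrMr.
move=> x xQ xF'.
have [z zF zx] := cube2_cells M0 xQ.
have /allPn[t tts] : ~~ all (fun t => (z - t)%R \notin A) ts.
  by apply/negP => zts; apply: xF'; exists z => //=; rewrite mem_filter zts.
rewrite negbK => /AH ztH.
have /lt_maximal_operatorP[P [BP dP] aP] : H (x - lattice_point M t)%R.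
  by apply: ztH; apply/cell_translate => //; rewrite subrK.
pose P' := [set (lattice_point M t + y)%R | y in P].
have BP' : B x P'.
  by have := translate_basis (lattice_point M t) TI BP; rewrite addrC subrK.
have dP' : diameter P' < r%:E by rewrite diameter_translate.
have [dB _] := BF.
have [_ bP _] := dB x; have [_ oP' P'x] := bP _ BP'.
have [_ bP1 _] := dB (x - lattice_point M t)%R.
have [_ oP _] := bP1 _ BP.
exists P'; split => //; apply: (lt_le_trans aP).
rewrite !average_indic//; try exact: lebesgue_measurable_open.
rewrite lebesgue_outer_translate lee_wpmul2l//.
  by rewrite inve_ge0 lebesgue_outer_ge0.
rewrite -(lebesgue_outer_translate (lattice_point M t)).
apply: le_lebesgue_outer => _ [y [Py Ey] <-]; split; first by exists y.
exists t => //; split; first by exists y.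
(* As diameters are below 1, a set of the basis meeting [cube2] stays inside
   [cube4], so cutting the translate of E down to [cube4] loses nothing. *)
have P'y : P' (lattice_point M t + y)%R by exists y.
move=> i; have := lt_diameter_coord dP' P'x P'y i; have := xQ i.
by rewrite [in X in _ -> _ -> X]/= !mxE ltr_norml /=; lra.
Qed.

(** * Density points *)

Lemma basis_setP B x A : busemann_feller_basis B -> B x A ->
  [/\ lebesgue_measurable A, open A, A x & 0 < mu A < +oo].
Proof.
move=> [dB _] BA; have [_ /(_ A BA)[bA oA Ax] _] := dB x; split => //.
  exact: lebesgue_measurable_open.
by rewrite lebesgue_outer_open_gt0 ?lebesgue_outer_bounded//; exists x.
Qed.

Lemma le_average A E D : lebesgue_measurable A -> lebesgue_measurable E ->
  lebesgue_measurable D -> E `<=` D ->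
  average A (\1_E : V -> R) <= average A (\1_D : V -> R).
Proof.
move=> mA mE mD ED; rewrite !average_indic// lee_wpmul2l//.
  by rewrite inve_ge0 lebesgue_outer_ge0.
by apply: le_lebesgue_outer; exact: setIS.
Qed.

(** The two averages are complementary because [A] has finite positive
    measure. *)
Lemma average_split A E D : lebesgue_measurable A -> lebesgue_measurable E ->
  lebesgue_measurable D -> 0 < mu A < +oo -> A `&` D = A `\` E ->
  exists p : R, [/\ (0 <= p <= 1)%R, average A (\1_E : V -> R) = p%:E &
    average A (\1_D : V -> R) = (1 - p)%:E].
Proof.
move=> mA mE mD /andP[A0 Aoo] AD; rewrite !average_indic// AD.
have Afin : mu A \is a fin_num by rewrite ge0_fin_numE ?lebesgue_outer_ge0.
have sub_fin X : mu (A `&` X) \is a fin_num.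
  rewrite ge0_fin_numE ?lebesgue_outer_ge0//; apply: le_lt_trans Aoo.
  by apply: le_lebesgue_outer; exact: subIsetl.
have A_split : mu A = mu (A `&` E) + mu (A `\` E) by exact: (mE A).
have v0 : (0 < fine (mu A))%R by apply: fine_gt0; rewrite A0.
have E_ge0 : (0 <= fine (mu (A `&` E)))%R by rewrite fine_ge0 ?lebesgue_outer_ge0.
have D_ge0 : (0 <= fine (mu (A `\` E)))%R by rewrite fine_ge0 ?lebesgue_outer_ge0.
rewrite -(fineK Afin) inver gt_eqF// in A_split *.
move: A_split; rewrite -(fineK (sub_fin E)) -(fineK (sub_fin (~` E))) -EFinD => -[].
rewrite -[A `&` ~` E]/(A `\` E); move: E_ge0 D_ge0 v0.
set p := fine (mu (A `&` E)); set q := fine (mu (A `\` E)); set v := fine (mu A).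
move=> p0 q0 v0 vpq; exists (v^-1 * p)%R; split => //.
  rewrite mulr_ge0 ?invr_ge0 ?(ltW v0)//= mulrC ler_pdivrMr// mul1r vpq.
  by rewrite lerDl.
rewrite -EFinM; congr _%:E; rewrite -[1%R](mulVf (lt0r_neq0 v0)).
by rewrite -mulrBr vpq addrAC subrr add0r.
Qed.

(** Phrased by scales rather than by sequences: at a point of [E] outside this
    set there is one scale below which every set of the basis has average at
    least [1 - a], and this serves all sequences at once. *)
Definition low_density B E (a : R) : set V := [set x | E x /\
  forall s : R, (0 < s)%R -> exists A,
    [/\ B x A, diameter A < s%:E & average A (\1_E : V -> R) < (1 - a)%:E]].

(** If [U] is open and contains [E], the exceptional points lie in the level
    set at height [a] of the maximal operator applied to the indicator of the
    difference; its measure is controlled by that of the difference, which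
    outer regularity makes small. *)
Lemma low_density_null_finite B E (a r : R) : busemann_feller_basis B ->
  lebesgue_measurable E -> mu E < +oo -> (0 < a)%R -> (0 < r)%R ->
  tauberian_constant (truncated_basis B r) a < +oo ->
  mu (low_density B E a) = 0.
Proof.
move=> BF mE Eoo a0 r0 tau.
have [C C0 tauC] : exists2 C : R, (0 < C)%R &
    tauberian_constant (truncated_basis B r) a <= C%:E.
  case: tauberian_constant tau => [t _|//|_]; last by exists 1%R => //; exact: leNye.
  exists (`|t| + 1)%R; first by rewrite ltr_pwDr.
  by rewrite lee_fin; have := ler_norm t; lra.
apply: lebesgue_outer_le0.
apply/lee_addgt0Pr => e e0; rewrite add0e.
have eC : (0 < e / C)%R by rewrite divr_gt0.
have [U [oU EU UE]] := lebesgue_outer_regular Eoo eC.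
have mU := lebesgue_measurable_open oU.
pose D := U `\` E.
have mD : lebesgue_measurable D by exact: (@measurableD _ (caratheodory_type mu)).
have De : mu D <= (e / C)%:E.
  have Efin : mu E \is a fin_num by rewrite ge0_fin_numE ?lebesgue_outer_ge0.
  have : mu U = mu E + mu D.
    have -> : mu U = mu (U `&` E) + mu (U `\` E) by exact: (mE U).
    by rewrite (setIidr EU).
  by move: UE => /[swap] ->; rewrite leeD2lE.
pose H := [set x | a%:E < maximal_operator (truncated_basis B r) (\1_D : V -> R) x].
(* A small set of the basis around a point of E lies in U, where a lack of E is
   an excess of U minus E. *)
have lowH : low_density B E a `<=` H.
  move=> x [Ex low].
  have /nbhs_ballP[d /= d0 xU] : nbhs x U.
    by apply: open_nbhs_nbhs; split => //; exact: EU.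
  have [|A [BA dA aA]] := low (Num.min r d); first by rewrite lt_min r0.
  have [mA _ Ax Av] := basis_setP BF BA.
  have AU : A `<=` U.
    move=> y Ay; apply: xU; apply/rV_ballP => // i.
    by apply: lt_le_trans (lt_diameter_coord dA Ax Ay i) _; rewrite ge_min lexx orbT.
  apply/lt_maximal_operatorP; exists A.
    by split => //; apply: lt_le_trans dA _; rewrite lee_fin ge_min lexx.
  have [|p [_ pE ->]] := average_split mA mE mD Av.
    by rewrite setIDA (setIidl AU).
  by move: aA; rewrite pE !lte_fin; lra.
apply: (le_trans (le_lebesgue_outer lowH)).
(* The Tauberian constant only concerns sets of positive measure; for a null
   set the maximal operator vanishes. *)
have [D0|D0] := eqVneq (mu D) 0.
  rewrite (_ : H = set0) ?lebesgue_outer0 ?lee_fin ?ltW//.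
  rewrite -subset0 => x /lt_maximal_operatorP[A [BA _]].
  have [mA _ _ _] := basis_setP BF BA.
  have AD0 : mu (A `&` D) = 0.
    apply: lebesgue_outer_le0; rewrite -D0.
    by apply: le_lebesgue_outer; exact: subIsetr.
  by rewrite average_indic// AD0 mule0 lte_fin ltNge ltW.
have Dfin : mu D \is a fin_num.
  by rewrite ge0_fin_numE ?lebesgue_outer_ge0//; apply: le_lt_trans De (ltry _).
have Dgt0 : 0 < mu D by rewrite lt0e D0 lebesgue_outer_ge0.
have : (mu D)^-1 * mu H <= C%:E.
  apply: le_trans tauC; apply: ereal_sup_ubound; exists D => //; split => //.
  by rewrite Dgt0 -ge0_fin_numE ?lebesgue_outer_ge0.
have v0 : (0 < fine (mu D))%R.
  by apply: fine_gt0; rewrite Dgt0 -ge0_fin_numE ?lebesgue_outer_ge0.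
rewrite -(fineK Dfin) inver gt_eqF// lee_pdivrMl// => /le_trans; apply.
by rewrite -EFinM lee_fin -ler_pdivlMr// -lee_fin fineK.
Qed.

(** Intersecting [E] with bounded boxes lowers its averages, so it only
    enlarges the exceptional set at the points that are kept. *)
Lemma low_density_null B E (a : R) : busemann_feller_basis B ->
  lebesgue_measurable E -> (0 < a < 1)%R ->
  (forall b : R, (0 < b < 1)%R -> exists2 r : R, (0 < r)%R &
       tauberian_constant (truncated_basis B r) b < +oo) ->
  mu (low_density B E a) = 0.
Proof.
move=> BF mE a01 /(_ a a01)[r r0 tau].
pose Q k : set V := box (const_mx (- k%:R)%R, const_mx k%:R).
have mQ k : lebesgue_measurable (Q k) by exact: lebesgue_measurable_box.
have mEQ k : lebesgue_measurable (E `&` Q k).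
  exact: (@measurableI _ (caratheodory_type mu) _ _ mE (mQ k)).
have low0 k : mu (low_density B (E `&` Q k) a) = 0.
  apply: low_density_null_finite tau => //; last by case/andP: a01.
  apply: (@le_lt_trans _ _ (mu (Q k))).
    by apply: le_lebesgue_outer; exact: subIsetr.
  exact: le_lt_trans (lebesgue_outer_box _) (ltry _).
have lowE : low_density B E a `<=` \bigcup_k low_density B (E `&` Q k) a.
  move=> x [Ex low].
  have [k _ [xk _]] : (\bigcup_k core setT k) x by rewrite bigcup_core//; exact: openT.
  exists k => //; split => // s /low[A [BA dA aA]]; exists A; split => //.
  have [mA _ _ _] := basis_setP BF BA.
  by apply: le_lt_trans aA; apply: le_average => //; exact: subIsetl.
apply: lebesgue_outer_le0.
apply: (le_trans (le_lebesgue_outer lowE)).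
apply: (le_trans (lebesgue_outer_bigcup _)).
by rewrite eseries0.
Qed.

(** Off the exceptional sets of [E] and of its complement for the parameters
    1/(m+2), the averages of one of the two indicators tend to 1. *)
Lemma tauberian_imp_density B : busemann_feller_basis B ->
  (forall b : R, (0 < b < 1)%R -> exists2 r : R, (0 < r)%R &
       tauberian_constant (truncated_basis B r) b < +oo) ->
  density_basis B.
Proof.
move=> BF tau E mE.
have mEc : lebesgue_measurable (~` E) by exact: (@measurableC _ (caratheodory_type mu)).
pose Nl X := \bigcup_m low_density B X (m.+2%:R^-1)%R.
have Nl0 X : lebesgue_measurable X -> mu (Nl X) = 0.
  move=> mX; apply: lebesgue_outer_le0.
  apply: (le_trans (lebesgue_outer_bigcup _)).
  rewrite eseries0// => m _ _; apply: low_density_null => //.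
  by rewrite invr_gt0 ltr0n invf_lt1 ?ltr0n// ltr1n.
have mNl X : lebesgue_measurable X -> lebesgue_measurable (Nl X).
  by move=> mX; exact: lebesgue_measurable_null (Nl0 X mX).
exists (Nl E `|` Nl (~` E)); split.
- by apply: (@measurableU _ (caratheodory_type mu)); exact: mNl.
- apply: lebesgue_outer_le0.
  apply: (le_trans (outer_measureU2 mu _ _)).
  by rewrite [X in X + _ <= _](Nl0 E mE) [X in _ + X <= _](Nl0 _ mEc) adde0.
have dense X x (A : nat -> set V) : lebesgue_measurable X -> X x -> ~ Nl X x ->
    (forall j, B x (A j)) -> diameter (A j) @[j --> \oo] --> 0 ->
    forall e : R, (0 < e)%R -> \forall j \near \oo,
      (1 - e)%:E <= average (A j) (\1_X : V -> R).
  move=> mX Xx nX BA dA e e0.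
  pose m := Num.truncn e^-1.
  have me : (m.+2%:R^-1 <= e)%R.
    rewrite invf_ple ?posrE ?ltr0n//; apply/ltW/(lt_trans (truncnS_gt _)).
    by rewrite ltr_nat.
  have [s s0 sA] : exists2 s : R, (0 < s)%R & forall P, B x P -> diameter P < s%:E ->
      (1 - m.+2%:R^-1)%:E <= average P (\1_X : V -> R).
    apply: contrapT => nos; apply: nX; exists m => //; split => // s s0.
    apply: contrapT => noA; apply: nos; exists s => // P BP dP.
    by rewrite leNgt; apply/negP => Pm; apply: noA; exists P.
  have : \forall j \near \oo, diameter (A j) < s%:E.
    apply: (dA [set y : \bar R | y < s%:E]); apply: open_nbhs_nbhs.
    split; last by rewrite /= lte_fin.
    exact: open_ereal_lt_ereal.
  apply: filterS => j /(sA _ (BA j)); apply: le_trans.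
  by rewrite lee_fin lerD2l lerN2.
move=> x; apply: contra_notP => /not_orP[nE nEc] A BA dA.
have /choice[p pP] : forall j, exists p : R, [/\ (0 <= p <= 1)%R,
    average (A j) (\1_E : V -> R) = p%:E &
    average (A j) (\1_(~` E) : V -> R) = (1 - p)%:E].
  move=> j; have [mA _ _ Av] := basis_setP BF (BA j).
  exact: average_split.
have -> : (fun j => average (A j) (\1_E : V -> R)) = EFin \o p.
  by apply/funext => j; have [] := pP j.
apply: cvg_EFin; first by near=> j.
apply/cvgrPdist_le => e e0.
have [Ex|Ex] := pselect (E x).
  rewrite indicE mem_set//=.
  apply: filterS (dense E x A mE Ex nE BA dA e e0) => j.
  by have [/andP[p0 p1] -> _] := pP j; rewrite lee_fin ler_norml; lra.
rewrite indicE memNset//=.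
apply: filterS (dense _ x A mEc Ex nEc BA dA e e0) => j.
by have [/andP[p0 p1] _ ->] := pP j; rewrite lee_fin ler_norml; lra.
Unshelve. all: by end_near. Qed.

(** The scale 1/(k+1) is treated with the error 2^-(k+3), so that the errors
    add up to 1/4. *)
Lemma density_imp_tauberian B : busemann_feller_basis B -> translation_invariant B ->
  density_basis B -> forall a : R, (0 < a < 1)%R -> exists2 r : R, (0 < r)%R &
       tauberian_constant (truncated_basis B r) a < +oo.
Proof.
move=> BF TI dens a /andP[a0 a1]; apply: contrapT => tau.
have {}tau (r : R) : (0 < r)%R -> tauberian_constant (truncated_basis B r) a = +oo.
  move=> r0; apply/eqP/negPn/negP => tr; apply: tau; exists r => //.
  by rewrite ltey.
pose e k : R := (4^-1 / (2 ^ k.+1)%:R)%R.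
have e_gt0 k : (0 < e k)%R by rewrite divr_gt0 ?ltr0n ?expn_gt0.
have /choice[W WP] : forall k, exists W : set V * set V,
    [/\ lebesgue_measurable W.1, mu W.1 <= (e k)%:E, mu W.2 <= (e k)%:E &
    forall x, cube2 x -> ~ W.2 x -> exists A,
      [/\ B x A, diameter A < (k.+1%:R^-1)%:E & a%:E < average A (\1_(W.1) : V -> R)]].
  move=> k; have k0 : (0 < k.+1%:R^-1 :> R)%R by rewrite invr_gt0 ltr0n.
  have [|G [U GU]] := spread_level_set BF TI _ (e_gt0 k) (tau _ k0).
    by rewrite k0 invf_le1 ?ltr0n// ler1n.
  by exists (G, U).
have sum_e (X : nat -> set V) : (forall k, mu (X k) <= (e k)%:E) ->
    mu (\bigcup_k X k) <= (4^-1)%:E.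
  move=> Xe; apply: (le_trans (lebesgue_outer_bigcup _)).
  apply: (@le_trans _ _ (\sum_(k <oo) (0 + (4^-1 / (2 ^ k.+1)%:R)%:E))).
    apply: lee_nneseries => [k _ _|k _]; first exact: lebesgue_outer_ge0.
    by rewrite add0e; exact: Xe.
  apply: le_trans (epsilon_trick xpredT _ _) _ => //.
  by rewrite eseries0// add0e.
pose G := \bigcup_k (W k).1; pose U := \bigcup_k (W k).2.
have mG : lebesgue_measurable G.
  by apply: (@bigcupT_measurable _ (caratheodory_type mu)) => k; have [] := WP k.
have G4 : mu G <= (4^-1)%:E by apply: sum_e => k; have [] := WP k.
have U4 : mu U <= (4^-1)%:E by apply: sum_e => k; have [] := WP k.
have [N [mN N0 dN]] := dens G mG.
have [x [xQ xG xU xN]] : exists x, [/\ cube2 x, ~ G x, ~ U x & ~ N x].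
  apply: contrapT => nox.
  have : cube2 `<=` G `|` (U `|` N).
    move=> x xQ; apply: contrapT => /not_orP[xG /not_orP[xU xN]].
    by apply: nox; exists x.
  move/le_lebesgue_outer; apply/negP; rewrite -ltNge.
  apply: lt_le_trans (lebesgue_outer_cube2).
  apply: (le_lt_trans (outer_measureU2 mu _ _)).
  apply: (@le_lt_trans _ _ ((4^-1)%:E + ((4^-1)%:E + 0))).
    apply: leeD => //; apply: (le_trans (outer_measureU2 mu _ _)).
    by apply: leeD => //; rewrite -N0.
  by rewrite adde0 -EFinD lte_fin; lra.
have /choice[A AP] : forall k, exists A, [/\ B x A, diameter A < (k.+1%:R^-1)%:E &
    a%:E < average A (\1_G : V -> R)].
  move=> k; have [mW _ _ /(_ x xQ)[|A [BA dA aA]]] := WP k.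
    by move=> xk; apply: xU; exists k.
  exists A; split => //; apply: lt_le_trans aA _.
  have [mA _ _ _] := basis_setP BF BA.
  by apply: le_average => //; move=> y Wy; exists k.
have dA0 : diameter (A j) @[j --> \oo] --> 0.
  apply: (@squeeze_cvge _ _ _ _ (cst 0) _ (fun k => (k.+1%:R^-1)%:E)).
  - near=> k; have [BA /ltW dA _] := AP k; rewrite dA andbT.
    by apply: diameter_ge0; exists x; have [] := basis_setP BF BA.
  - exact: cvg_cst.
  - exact: cvge_harmonic.
have : average (A j) (\1_G : V -> R) @[j --> \oo] --> (\1_G x : R)%:E.
  apply: contrapT => nlim; apply: xN; apply: dN => lim; apply: nlim.
  by apply: lim => // k; have [] := AP k.
rewrite indicE memNset// => /cvge_to_ge -/(_ a%:E) H.
have : a%:E <= 0%:E by apply: H; near=> k; have [_ _ /ltW] := AP k.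
by rewrite lee_fin leNgt a0.
Unshelve. all: by end_near. Qed.

End DensityBases.

Theorem corollary1 (R : realType) (n : nat)
    (B : 'rV[R]_n.+1 -> set (set 'rV[R]_n.+1)) :
  busemann_feller_basis B -> translation_invariant B ->
  (density_basis B <->
   forall alpha : R, (0 < alpha < 1)%R ->
     exists2 r : R, (0 < r)%R &
       tauberian_constant (truncated_basis B r) alpha < +oo).
Proof.
move=> BF TI; split; first exact: density_imp_tauberian.
exact: tauberian_imp_density.
Qed.
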